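(* Let $\{\theta_t\}$ be generated by AEGDM (defined in the context) with $0\le\mu<1$ and $\eta>0$. Let $\Theta\subseteq\mathbb{R}^n$ be a feasible set containing all iterates $\theta_t$, and assume that $\|\theta-\theta'\|_\infty\le D_\infty$ for all $\theta,\theta'\in\Theta$, and $0<f_t(\theta_t)+c\le B$ for all $t\in\{0,\dots,T-1\}$. If $\Theta$ and the functions $f_t$ are convex, then for all $T\ge1$ the regret satisfies $$R(T)\le C_1\left(\sum_{i=1}^n\frac{1}{\eta\, r_{T,i}}\right)^{1/2}\sqrt{T}+C_2,$$ where $C_1,C_2$ are constants depending only on $\mu$, $D_\infty$, $B$, $n$ and $f_0(\theta_0)+c$ (in particular not on $T$ or $\eta$).
   Context: Let $f_t:\mathbb{R}^n\to\mathbb{R}$, $t=0,1,2,\dots$, be differentiable functions and $c$ a constant such that $f_t(\theta)+c>0$ for all $t$ and all $\theta\in\mathbb{R}^n$. Let $\theta_0\in\mathbb{R}^n$. AEGDM with step size $\eta$ and momentum parameter $\mu$ is the iteration, for $t\ge 0$ and $i\in\{1,\dots,n\}$, $$v_{t,i}=\frac{\partial_i f_t(\theta_t)}{2\sqrt{f_t(\theta_t)+c}},\qquad m_{t+1,i}=\mu m_{t,i}+v_{t,i},\quad m_{0,i}=0,$$ $$r_{t+1,i}=\frac{r_{t,i}}{1+2\eta v_{t,i}^2},\quad r_{0,i}=\sqrt{f_0(\theta_0)+c},\qquad \theta_{t+1,i}=\theta_{t,i}-2\eta\, r_{t+1,i}m_{t+1,i}.$$ The regret is $$R(T)=\sum_{t=0}^{T-1}\big[f_t(\theta_t)-f_t(\theta^*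 )\big],\qquad \theta^*\in\operatorname{argmin}_{\theta\in\Theta}\sum_{t=0}^{T-1}f_t(\theta),$$ where such a minimizer $\theta^*$ is assumed to exist. *)

(* Defs.v *)
From HB Require Import structures.
From mathcomp Require Export all_boot all_order all_algebra.
From mathcomp Require Export all_classical all_reals all_analysis.

Set Implicit Arguments.
Unset Strict Implicit.
Unset Printing Implicit Defensive.

Export Order.TTheory GRing.Theory Num.Theory.
Export numFieldNormedType.Exports.

Local Open Scope classical_set_scope.
Local Open Scope ring_scope.

(* Points of R^n are row vectors; their canonical norm `|x| is the max norm
   (mx_norm), i.e. the l^infinity norm. *)

Definition partial (R : realType) (n : nat) (g : 'rV[R]_n -> R) (i : 'I_n)
    (x : 'rV[R]_n) : R :=
  'D_(delta_mx 0 i) g x.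

Record aegdm_state (R : realType) (n : nat) := AEGDMState {
  iterate : 'rV[R]_n;
  momentum : 'rV[R]_n;
  energy : 'rV[R]_n
}.

(* The gradient at x of y |-> sqrt (g y + c). *)
Definition aegdm_v (R : realType) (n : nat) (c : R) (g : 'rV[R]_n -> R)
    (x : 'rV[R]_n) : 'rV[R]_n :=
  \row_i (partial g i x / (2 * Num.sqrt (g x + c))).

Definition aegdm_step (R : realType) (n : nat) (c eta mu : R)
    (g : 'rV[R]_n -> R) (s : aegdm_state R n) : aegdm_state R n :=
  let v := aegdm_v c g (iterate s) in
  let m := \row_i (mu * momentum s 0 i + v 0 i) in
  let r := \row_i (energy s 0 i / (1 + 2 * eta * v 0 i ^+ 2)) in
  let x := \row_i (iterate s 0 i - 2 * eta * r 0 i * m 0 i) in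
  AEGDMState x m r.

Fixpoint aegdm (R : realType) (n : nat) (f : nat -> 'rV[R]_n -> R)
    (c eta mu : R) (theta0 : 'rV[R]_n) (t : nat) : aegdm_state R n :=
  if t is t'.+1 then aegdm_step c eta mu (f t') (aegdm f c eta mu theta0 t')
  else AEGDMState theta0 0 (const_mx (Num.sqrt (f 0%N theta0 + c))).

Definition is_argmin (R : realType) (X : Type) (A : set X) (F : X -> R)
    (x : X) : Prop :=
  A x /\ forall y, A y -> F x <= F y.

Definition regret (R : realType) (n : nat) (f : nat -> 'rV[R]_n -> R)
    (theta : nat -> 'rV[R]_n) (thetastar : 'rV[R]_n) (T : nat) : R :=
  \sum_(0 <= t < T) (f t (theta t) - f t thetastar).

(* Main.v *)
Require Import Defs.
From mathcomp Require Import ring lra.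

Local Open Scope classical_set_scope.
Local Open Scope ring_scope.

(** The regret bound rests on three facts. Write [s_t] for the square root of
    [f_t(theta_t) + c], so that the gradient of [f_t] at [theta_t] is
    [2 s_t v_t] with [s_t <= sqrt B].

    Convexity bounds each regret term by a linear one
    ([convex_diff_ge], [convex_gradient_ge]):
    [f_t(theta_t) - f_t(w) <= 2 s_t sum_i v_(t,i) (theta_(t,i) - w_i)] for the
    minimizer [w], and the diameter of the feasible set bounds this by
    [2 sqrt B Dinf sum_i |v_(t,i)|] ([regret_term_le]).

    Summing over [t] leaves an l^1 norm of the [n T] numbers [v_(t,i)], which
    Cauchy-Schwarz ([sum_le_sqrt_card]) turns into [sqrt (n T)] times their
    l^2 norm.

    The energy controls that l^2 norm ([energy_sum_sqr_le]): since
    [prod_t (1 + 2 eta v_t^2) >= 1 + 2 eta sum_t v_t^2], the recursion for [r]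
    gives [2 eta sum_t v_(t,i)^2 <= r_(0,i) / r_(T,i)].

    The distance from the iterate to [w] is bounded separately at each step, so
    the displacements of the iterates need not be telescoped and no additive
    remainder appears: [C2] is [0]. *)

(** Cauchy-Schwarz against the constant vector [1]. *)
Lemma sum_le_sqrt_card (R : rcfType) (I : finType) (x : I -> R) :
  \sum_i x i <= Num.sqrt #|I|%:R * Num.sqrt (\sum_i x i ^+ 2).
Proof.
rewrite -sqrtrM ?ler0n//.
have [S0|S0] := leP (\sum_i x i) 0; first exact: le_trans (sqrtr_ge0 _).
rewrite -(ger0_norm (ltW S0)) -sqrtr_sqr ler_wsqrtr//.
(* Expand both sides as double sums: [2 x_i x_j <= x_i^2 + x_j^2] termwise. *)
have : \sum_i \sum_j (2 * (x i * x j)) <= \sum_i \sum_j (x i ^+ 2 + x j ^+ 2).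
  apply: ler_sum => i _; apply: ler_sum => j _.
  by have := sqr_ge0 (x i - x j); lra.
have -> : \sum_i \sum_j (2 * (x i * x j)) = 2 * (\sum_i x i) ^+ 2.
  rewrite expr2 mulr_suml mulr_sumr; apply: eq_bigr => i _.
  by rewrite mulr_sumr mulr_sumr.
have -> : \sum_i \sum_j (x i ^+ 2 + x j ^+ 2)
          = 2 * (#|I|%:R * \sum_i x i ^+ 2).
  under eq_bigr do rewrite big_split /= sumr_const.
  by rewrite big_split /= sumr_const sumrMnl !mulr_natl -mulr2n.
by rewrite ler_pM2l.
Qed.

(** The difference quotients of [f] at [x] in the direction [y - x] are at most
    [f y - f x] for steps in [(0, 1]]; a one-sided limit preserves this. *)
Lemma convex_diff_ge (R : realType) (V : normedModType R) (f : V -> R)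
    (x y : V) :
  convex_function setT f -> differentiable f x ->
  'd f x (y - x) <= f y - f x.
Proof.
move=> fconv df; rewrite -deriveE//.
have Df : h^-1 *: ((f \o shift x) (h *: (y - x)) - f x) @[h --> 0^'+] -->
    'D_(y - x) f x.
  exact/cvg_dnbhs_at_right/diff_derivable.
apply: (cvgr_to_le Df); near=> h.
have h0 : 0 < h by [].
have h1 : h <= 1 by near: h; exact: nbhs_right_le.
rewrite /= -[_ *: _]/(h^-1 * _) mulrC ler_pdivrMr// lerBlDl.
have := fconv (Itv01 (ltW h0) h1) y x; rewrite !inE => /(_ I I).
have -> : h *: (y - x) + x = h *: y + (1 - h) *: x.
  by rewrite scalerBr scalerBl scale1r addrAC addrA.
move=> fh; apply: (le_trans fh).
by rewrite convRE/= /unstable.onem; lra.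
Unshelve. all: by end_near. Qed.

(** The gradient inequality in coordinates: expand the differential along
    [x - y] in the canonical basis. *)
Lemma convex_gradient_ge (R : realType) (n : nat) (f : 'rV[R]_n -> R)
    (x y : 'rV[R]_n) :
  convex_function setT f -> differentiable f x ->
  f x - f y <= \sum_i (x 0 i - y 0 i) * partial f i x.
Proof.
move=> fconv df; have := convex_diff_ge _ _ _ _ y fconv df.
rewrite -(opprB x y) linearN/= lerNl opprB => /le_trans; apply.
rewrite [X in 'd f x X]row_sum_delta linear_sum/=.
by apply: ler_sum => i _; rewrite linearZ/= !mxE /partial deriveE.
Qed.

Section energy.
Variables (R : realType) (n : nat) (f : nat -> 'rV[R]_n -> R).
Variables (c eta mu : R) (theta0 : 'rV[R]_n).
Hypotheses (f_gt0 : 0 < f 0%N theta0 + c) (eta_gt0 : 0 < eta).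

Let s t := aegdm f c eta mu theta0 t.
Let v t := aegdm_v c (f t) (iterate (s t)).

Lemma energyS t i :
  energy (s t.+1) 0 i * (1 + 2 * eta * v t 0 i ^+ 2) = energy (s t) 0 i.
Proof.
rewrite mxE divfK// gt_eqF// ltr_pwDl// mulr_ge0 ?sqr_ge0//.
by rewrite mulr_ge0 ?ltW.
Qed.

Lemma energy_gt0 t i : 0 < energy (s t) 0 i.
Proof.
elim: t => [|t IH]; first by rewrite mxE sqrtr_gt0.
move: IH; rewrite -energyS pmulr_lgt0// ltr_pwDl// mulr_ge0 ?sqr_ge0//.
by rewrite mulr_ge0 ?ltW.
Qed.

(** The telescoped product of the factors [1 + 2 eta v_t^2] dominates one plus
    the sum of the [2 eta v_t^2]. *)
Lemma energy_mul_sum_sqr_le T i :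
  energy (s T) 0 i * (1 + 2 * eta * \sum_(t < T) v t 0 i ^+ 2)
  <= Num.sqrt (f 0%N theta0 + c).
Proof.
elim: T => [|T]; first by rewrite big_ord0 mulr0 addr0 mulr1 mxE.
apply: le_trans; rewrite big_ord_recr/= -(energyS T i) -[leRHS]mulrA.
rewrite ler_pM2l; last exact: (energy_gt0 T.+1 i).
set S := \sum_(_ < _) _; set a := v T 0 i ^+ 2.
have S0 : 0 <= eta * S.
  by apply: mulr_ge0 (ltW eta_gt0) _; apply: sumr_ge0 => t _; exact: sqr_ge0.
have a0 : 0 <= eta * a by exact: mulr_ge0 (ltW eta_gt0) (sqr_ge0 _).
have := mulr_ge0 S0 a0; lra.
Qed.

Lemma energy_sum_sqr_le T i :
  \sum_(t < T) v t 0 i ^+ 2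
  <= Num.sqrt (f 0%N theta0 + c) / 2 * (1 / (eta * energy (s T) 0 i)).
Proof.
have rT0 := energy_gt0 T i.
rewrite mul1r ler_pdivlMr ?mulr_gt0//.
by have := energy_mul_sum_sqr_le T i; lra.
Qed.

End energy.

Lemma norm_coord_le_mx_norm (R : realType) (n : nat) (x : 'rV[R]_n) i :
  `|x 0 i| <= `|x|.
Proof.
rewrite /Num.norm/= mx_normrE.
exact: (le_bigmax 0 (fun ij => `|x ij.1 ij.2|) (0, i)).
Qed.

(** The gradient of [g] at [x] is [2 sqrt (g x + c)] times [aegdm_v], so the
    gradient inequality pairs [aegdm_v] with [x - y]; this is the l^1 - l^infinity
    duality bound. *)
Lemma regret_term_le (R : realType) (n : nat) (g : 'rV[R]_n -> R) (c B D : R)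
    (x y : 'rV[R]_n) :
  convex_function setT g -> differentiable g x -> 0 < g x + c <= B ->
  `|x - y| <= D ->
  g x - g y <= 2 * Num.sqrt B * D * \sum_i `|aegdm_v c g x 0 i|.
Proof.
move=> gconv dg /andP[gx0 gxB] xyD.
apply: (le_trans (convex_gradient_ge _ _ _ _ _ gconv dg)).
rewrite mulr_sumr; apply: ler_sum => i _.
have s0 : 0 < Num.sqrt (g x + c) by rewrite sqrtr_gt0.
have -> : partial g i x = 2 * Num.sqrt (g x + c) * aegdm_v c g x 0 i.
  by rewrite mxE mulrC divfK// mulf_neq0 ?pnatr_eq0// gt_eqF.
apply: (le_trans (ler_norm _)); rewrite mulrA normrM.
apply: ler_wpM2r => //; rewrite normrM [leLHS]mulrC.
rewrite (@ger0_norm _ (2 * _)); last by rewrite mulr_ge0.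
apply: ler_pM => //.
- by rewrite ler_pM2l// ler_wsqrtr.
- apply: le_trans xyD.
  by have := norm_coord_le_mx_norm _ _ (x - y) i; rewrite !mxE.
Qed.

Theorem theorem4p3 (R : realType) (n : nat) (mu Dinf B F0 : R)
    (hmu : 0 <= mu < 1) :
  exists C1 C2 : R,
  forall (f : nat -> 'rV[R]_n -> R) (c : R) (theta0 : 'rV[R]_n) (eta : R)
    (Theta : set 'rV[R]_n),
    let theta t := iterate (aegdm f c eta mu theta0 t) in
    let r t := energy (aegdm f c eta mu theta0 t) in
    (forall t x, differentiable (f t) x) ->
    (forall t x, 0 < f t x + c) ->
    f 0%N theta0 + c = F0 ->
    0 < eta ->
    (forall t, Theta (theta t)) ->
    (forall x y, Theta x -> Theta y -> `|x - y| <= Dinf) ->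
    convex_set Theta ->
    (forall t, convex_function setT (f t)) ->
    forall (T : nat) (thetastar : 'rV[R]_n),
      (1 <= T)%N ->
      (forall t, (t < T)%N -> 0 < f t (theta t) + c <= B) ->
      is_argmin Theta (fun x => \sum_(0 <= t < T) f t x) thetastar ->
      regret f theta thetastar T <=
        C1 * Num.sqrt (\sum_(i < n) 1 / (eta * r T 0 i)) * Num.sqrt T%:R + C2.
Proof.
(* [2 sqrt B Dinf] comes from the gradient inequality, [sqrt n] from
   Cauchy-Schwarz, and [sqrt F0 / 2] is [r_0 / 2] in the energy estimate. *)
exists (2 * Num.sqrt B * Dinf * Num.sqrt n%:R * Num.sqrt (Num.sqrt F0 / 2)), 0.
move=> f c theta0 eta Theta theta r df f0 fF0 eta0 thetaTheta diam _ fconv.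
move=> T thetastar _ fB [starTheta _]; rewrite addr0.
have D0 : 0 <= Dinf.
  exact: le_trans (normr_ge0 _) (diam _ _ (thetaTheta 0%N) starTheta).
pose v t := aegdm_v c (f t) (theta t).
have K0 : 0 <= 2 * Num.sqrt B * Dinf by rewrite !mulr_ge0.
have sumv : \sum_(t < T) \sum_i `|v t 0 i| <=
    Num.sqrt T%:R * Num.sqrt n%:R *
    (Num.sqrt (Num.sqrt F0 / 2) * Num.sqrt (\sum_(i < n) 1 / (eta * r T 0 i))).
  rewrite pair_big/=; apply: le_trans (sum_le_sqrt_card _ _ _) _.
  rewrite card_prod !card_ord natrM sqrtrM ?ler0n//.
  apply: ler_wpM2l; first by rewrite mulr_ge0.
  rewrite -sqrtrM ?divr_ge0//; apply: ler_wsqrtr.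
  rewrite -(pair_big xpredT xpredT (fun (t : 'I_T) i => `|v t 0 i| ^+ 2))/=.
  rewrite exchange_big/= mulr_sumr; apply: ler_sum => i _.
  under eq_bigr do rewrite real_normK ?num_real//.
  by rewrite -fF0; exact: energy_sum_sqr_le.
rewrite /regret big_mkord.
apply: (@le_trans _ _
  (2 * Num.sqrt B * Dinf * \sum_(t < T) \sum_i `|v t 0 i|)).
  rewrite mulr_sumr; apply: ler_sum => t _.
  by apply: regret_term_le => //; [exact: fB|exact: diam].
by apply: le_trans (ler_wpM2l K0 sumv) _; lra.
Qed.
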